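(* Let $\delta t>0$ be arbitrary, and let $\phi^n\in V$ and $U^n\in L^2(\Omega)$ be given. Set $H^n=H(\phi^n)$, and let $\phi^{n+1},\mu^{n+1}\in V$, $U^{n+1}\in L^2(\Omega)$ solve the first order scheme $$\frac{\phi^{n+1}-\phi^n}{\delta t}=\nabla\cdot(M(\phi^n)\nabla\mu^{n+1}),$$ $$\mu^{n+1}=-\epsilon^2\Delta\phi^{n+1}+U^{n+1}H^n,$$ $$2(U^{n+1}-U^n)=H^n(\phi^{n+1}-\phi^n),$$ with either periodic boundary conditions for $\phi^{n+1},\mu^{n+1}$, or $\partial_{\mathbf n}\phi^{n+1}|_{\partial\Omega}=\nabla\mu^{n+1}\cdot\mathbf n|_{\partial\Omega}=0$. Then the scheme is unconditionally energy stable, satisfying the discrete energy dissipation law $$\frac1{\delta t}\left(E(\phi^{n+1},U^{n+1})-E(\phi^n,U^n)\right)\le-\left\|\sqrt{M(\phi^n)}\,\nabla\mu^{n+1}\right\|^2\le0,$$ where $E(\phi,U)=\frac{\epsilon^2}2\|\nabla\phi\|^2+\|U\|^2-B|\Omega|$.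
   Context: Setting. $\Omega\subset\mathbb R^d$ is a bounded connected Lipschitz domain (a rectangular box in the periodic case), $\mathbf n$ is its outward normal, $(\cdot,\cdot)$ and $\|\cdot\|$ are the $L^2(\Omega)$ inner product and norm. $V=H^1(\Omega)$ in the case of Neumann boundary conditions, and $V$ is the space of periodic $H^1(\Omega)$ functions in the periodic case. The first two equations are understood in the usual weak sense (tested with functions in $V$, integrating by parts using the boundary conditions): $\frac1{\delta t}(\phi^{n+1}-\phi^n,\chi)=-(M(\phi^n)\nabla\mu^{n+1},\nabla\chi)$ and $(\mu^{n+1},\chi)=\epsilon^2(\nabla\phi^{n+1},\nabla\chi)+(U^{n+1}H^n,\chi)$ for all $\chi\in V$; the third holds almost everywhere in $\Omega$. Parameters and functions. $\epsilon>0$, $\theta>1$, and $0<\sigma\ll1$ (in particular $\sigma<1/2$) are fixed constants. The mobility is $$M(\phi)=\begin{cases}\frac14\left(1-(1-\sigma)(2\phi-1)^2\right),&0\le\phi\le1,\\ \frac18\sigma\left(1+e^{-2(1-\sigma)((2\phi-1)^2-1)/\sigma}\right),&\text{otherwise.}\end{cases}$$ The (regularized) logarithmic Flory-Huggins potential $F:\mathbb R\to\mathbb R$ is $$F(\phi)=\begin{cases}\phi\ln\phi+\frac{(1-\phi)^2}{2\sigma}+(1-\phi)\ln\sigma-\frac\sigma2+\theta(\phi-\phi^2),&\phi\ge1-\sigma,\\ \phi\ln\phi+(1-\phi)\ln(1-\phi)+\theta(\phi-\phi^2),&\sigma\le\phi\le1-\sigma,\\ (1-\phi)\ln(1-\phi)+\frac{\phi^2}{2\sigma}+\phi\ln\sigma-\frac\sigma2+\theta(\phi-\phi^2),&\phi\le\sigma,\end{cases}$$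 $\sigma$ is small enough that $F$ is bounded below, $B$ is a constant with $F(x)+B>0$ for all $x\in\mathbb R$, $f=F'$, and $H(\phi)=f(\phi)/\sqrt{F(\phi)+B}$. *)

(* Defs.v *)
From HB Require Import structures.
From mathcomp Require Import all_boot all_order all_algebra.
From mathcomp Require Import all_classical all_reals all_analysis.
Import Order.TTheory GRing.Theory Num.Theory.
Import numFieldNormedType.Exports.

Set Implicit Arguments.
Unset Strict Implicit.
Unset Printing Implicit Defensive.

Local Open Scope classical_set_scope.
Local Open Scope ring_scope.

(* R^n is 'rV[R]_n. Its topology comes from the library (sup norm, hence the
   usual topology), its Euclidean structure is given by dotp. *)

(* The sigma-algebra on R^n generated by the coordinates, i.e. the Borel sets;
   this mirrors the library's instance for n.-tuple T. *)
Definition measure_rV_display : measure_display -> measure_display.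
Proof. exact. Qed.

Section measurable_rV.
Context {R : realType} (n : nat).

Let coors : 'I_n -> 'rV[R]_n -> measurableTypeR R := fun i x => x 0 i.

Let rV_set0 : g_sigma_preimage coors set0.
Proof. exact: sigma_algebra0. Qed.

Let rV_setC A : g_sigma_preimage coors A -> g_sigma_preimage coors (~` A).
Proof. exact: sigma_algebraC. Qed.

Let rV_bigcup (F : _^nat) : (forall i, g_sigma_preimage coors (F i)) ->
  g_sigma_preimage coors (\bigcup_i (F i)).
Proof. exact: sigma_algebra_bigcup. Qed.

HB.instance Definition _ :=
  @isMeasurable.Build (measure_rV_display default_measure_display)
    'rV[R]_n (g_sigma_preimage coors) rV_set0 rV_setC rV_bigcup.

End measurable_rV.

Section lebesgue_measure_rV.
Context {R : realType}.

Definition consrV n (p : measurableTypeR R * 'rV[R]_n) : 'rV[R]_n.+1 :=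
  \row_i (if unlift ord0 i is Some j then p.2 0 j else p.1).

Lemma measurable_coor n (i : 'I_n) :
  measurable_fun [set: 'rV[R]_n] (fun x : 'rV[R]_n => x 0 i : measurableTypeR R).
Proof.
move=> _ Y mY; rewrite setTI; apply: sub_sigma_algebra => /=.
rewrite -bigcup_seq/=; exists i => /=; first by rewrite mem_index_enum.
by exists Y => //; rewrite setTI.
Qed.

Lemma measurable_fun_rV d (T : measurableType d) n (f : T -> 'rV[R]_n) :
  (forall i, measurable_fun setT (fun x => f x 0 i : measurableTypeR R)) ->
  measurable_fun setT f.
Proof.
move=> mf _ A mA.
have : (preimage_set_system setT f (@measurable _ 'rV[R]_n)) (setT `&` f @^-1` A).
  by exists A.
rewrite -(@g_sigma_preimage_comp _ _ n _ (fun i (x : 'rV[R]_n) => x 0 i : measurableTypeR R)).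
apply: smallest_sub; first exact: sigma_algebra_measurable.
rewrite -bigcup_seq => B [i _ [C mC <-]]; exact: (mf i).
Qed.

Lemma measurable_consrV n : measurable_fun setT (@consrV n).
Proof.
apply: measurable_fun_rV => i.
case: (unliftP ord0 i) => [j|] ->.
  rewrite (_ : (fun x => _) = (fun x : 'rV[R]_n => x 0 j) \o snd); last first.
    by apply/funext => x /=; rewrite mxE liftK.
  by apply: measurableT_comp => //; exact: measurable_coor.
rewrite (_ : (fun x => _) = fst) //.
by apply/funext => x /=; rewrite mxE unlift_none.
Qed.

Definition unconsrV n (v : 'rV[R]_n.+1) : measurableTypeR R * 'rV[R]_n :=
  (v 0 ord0, \row_j v 0 (lift ord0 j)).

Lemma consrVK n : cancel (@consrV n) (@unconsrV n).
Proof.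
move=> [x v]; rewrite /unconsrV mxE unlift_none; congr pair.
by apply/rowP => j; rewrite !mxE liftK.
Qed.

Lemma unconsrVK n : cancel (@unconsrV n) (@consrV n).
Proof.
move=> v; apply/rowP => i; rewrite mxE.
by case: unliftP => [j|] -> //=; rewrite mxE.
Qed.

Lemma measurable_unconsrV n : measurable_fun setT (@unconsrV n).
Proof.
apply/measurable_fun_pairP; split; first exact: measurable_coor.
apply: measurable_fun_rV => j /=.
rewrite (_ : (fun x => _) =
  (fun x : 'rV[R]_n.+1 => x 0 (lift ord0 j))).
  exact: measurable_coor.
by apply/funext => x; rewrite mxE.
Qed.

Section lebesgue_succ.
Variables (n : nat) (m : {sigma_finite_measure set 'rV[R]_n -> \bar R}).

Definition lebesgue_succ : set 'rV[R]_n.+1 -> \bar R :=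
  pushforward (@lebesgue_measure R \x m)%E (@consrV n).

Let lebesgue_succ0 : lebesgue_succ set0 = 0%E.
Proof. by rewrite /lebesgue_succ /pushforward preimage_set0 measure0. Qed.

Let lebesgue_succ_ge0 A : (0 <= lebesgue_succ A)%E.
Proof. by rewrite /lebesgue_succ /pushforward measure_ge0. Qed.

Let lebesgue_succ_sigma_additive : semi_sigma_additive lebesgue_succ.
Proof.
have mT A : measurable A -> measurable (@consrV n @^-1` A).
  by move=> mA; rewrite -[X in measurable X]setTI; exact: measurable_consrV.
move=> F mF tF mUF; rewrite /lebesgue_succ /pushforward preimage_bigcup.
apply: measure_semi_sigma_additive.
- by move=> k; exact: mT.
- apply/trivIsetP => /= i j _ _ ij; rewrite -preimage_setI.
  by move/trivIsetP : tF => /(_ _ _ _ _ ij) ->//; rewrite preimage_set0.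
- by rewrite -preimage_bigcup; exact: mT.
Qed.

HB.instance Definition _ := isMeasure.Build _ _ _ lebesgue_succ
  lebesgue_succ0 lebesgue_succ_ge0 lebesgue_succ_sigma_additive.

Let lebesgue_succ_sigma_finite : sigma_finite setT lebesgue_succ.
Proof.
have /sigma_finiteP[F [TF ndF Foo]] := sigma_finiteT (@lebesgue_measure R).
have /sigma_finiteP[G [TG ndG Goo]] := sigma_finiteT m.
exists (fun k => @unconsrV n @^-1` (F k `*` G k)).
  rewrite -preimage_bigcup; apply/seteqP; split => // v _.
  have [/= i _ Fi] : (\bigcup_i F i) (v 0 ord0) by rewrite -TF.
  have [/= j _ Gj] : (\bigcup_i G i) (\row_j v 0 (lift ord0 j)) by rewrite -TG.
  exists (maxn i j) => //; split.
  - by move: Fi; exact/subsetPset/ndF/leq_maxl.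
  - by move: Gj; exact/subsetPset/ndG/leq_maxr.
move=> k; have [mFk Fkoo] := Foo k; have [mGk Gkoo] := Goo k; split.
  rewrite -[X in measurable X]setTI; apply: measurable_unconsrV => //.
  exact: measurableX.
rewrite /lebesgue_succ /pushforward -comp_preimage.
rewrite (_ : _ @^-1` _ = F k `*` G k).
  by rewrite product_measure1E// lte_mul_pinfty// ge0_fin_numE.
by rewrite (_ : _ \o _ = id) //; apply/funext => p; exact: consrVK.
Qed.

HB.instance Definition _ := Measure_isSigmaFinite.Build _ _ _ lebesgue_succ
  lebesgue_succ_sigma_finite.

End lebesgue_succ.

Fixpoint lebesgue_rV n : {sigma_finite_measure set 'rV[R]_n -> \bar R} :=
  if n is m.+1 then lebesgue_succ (lebesgue_rV m)
  else @dirac _ 'rV[R]_0 0 R.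

End lebesgue_measure_rV.

Definition box {R : realType} n (a b : 'rV[R]_n) : set 'rV[R]_n :=
  [set x | forall i, a 0 i < x 0 i < b 0 i].

Lemma lebesgue_rV_box (R : realType) n (a b : 'rV[R]_n) :
  (forall i, a 0 i <= b 0 i) ->
  lebesgue_rV n (box a b) = (\prod_i (b 0 i - a 0 i))%:E.
Proof.
elim: n a b => [|n IH] a b ab /=.
  rewrite big_ord0; rewrite diracE mem_set //.
  by move=> i; case: i.
rewrite /lebesgue_succ /pushforward.
rewrite (_ : _ @^-1` _ = `]a 0 ord0, b 0 ord0[%classic `*`
   box (\row_j a 0 (lift ord0 j)) (\row_j b 0 (lift ord0 j))); last first.
  apply/seteqP; split => -[x v] /=.
    move=> h; split.
      by have := h ord0; rewrite mxE unlift_none in_itv.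
    by move=> i; have := h (lift ord0 i); rewrite !mxE liftK.
  rewrite in_itv/= => -[h1 h2] i; rewrite mxE.
  by case: unliftP => [j|] -> //; have := h2 j; rewrite !mxE.
rewrite product_measure1E //; last first.
  rewrite (_ : box _ _ = \bigcap_(i in [set: 'I_n])
     (fun x : 'rV[R]_n => x 0 i : measurableTypeR R) @^-1`
        `]a 0 (lift ord0 i), b 0 (lift ord0 i)[%classic); last first.
    apply/seteqP; split => x /= h i; have := h i; rewrite /= in_itv/= !mxE //.
    by move/(_ I).
  apply: fin_bigcap_measurable => // i _.
  rewrite -[X in measurable X]setTI; exact: measurable_coor.
have := @lebesgue_measure_itv R `]a 0 ord0, b 0 ord0[; rewrite /= => ->.
rewrite IH; last by move=> i; rewrite !mxE.
rewrite big_ord_recl; case: ifPn.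
  by move=> _; rewrite EFinM EFinB; congr (_ * (_)%:E)%E; apply: eq_bigr => i _; rewrite !mxE.
rewrite lte_fin -leNgt => ba.
have -> : b 0 ord0 = a 0 ord0 by apply/eqP; rewrite eq_le ba ab.
by rewrite subrr mul0e mul0r.
Qed.

Section domains.
Context {R : realType} {d : nat}.
Implicit Types (D Omega : set 'rV[R]_d) (u : 'rV[R]_d -> R).

Definition dotp (v w : 'rV[R]_d) : R := \sum_i v 0 i * w 0 i.

(* Near each boundary point, Omega is the strict epigraph, in some unit
   direction e, of a Lipschitz function on the hyperplane orthogonal to e. *)
Definition lipschitz_boundary Omega : Prop :=
  forall x, (closure Omega `\` interior Omega) x ->
  exists r : R, exists e : 'rV[R]_d, exists gamma : 'rV[R]_d -> R,
    [/\ 0 < r, dotp e e = 1,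
        [lipschitz gamma z | z in [set z | dotp z e = 0]] &
        forall y, ball x r y ->
          (Omega y <-> gamma (y - dotp y e *: e) < dotp y e)].

(* The two boundary conditions, each with its domain: Omega for Neumann, the
   open box with corners a and b for periodic. *)
Variant setting :=
  | Neumann of set 'rV[R]_d
  | Periodic of 'rV[R]_d & 'rV[R]_d.

Definition domain (s : setting) : set 'rV[R]_d :=
  match s with
  | Neumann Omega => Omega
  | Periodic a b => box a b
  end.

Definition admissible (s : setting) : Prop :=
  match s with
  | Neumann Omega => [/\ open Omega, connected Omega, Omega !=set0,
                         bounded_set Omega & lipschitz_boundary Omega]
  | Periodic a b => forall i, a 0 i < b 0 i
  end.

End domains.
Arguments setting : clear implicits.

Section L2.
Context {R : realType} {d : nat}.
Implicit Types (D : set 'rV[R]_d) (f g : 'rV[R]_d -> R)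
  (v w : 'rV[R]_d -> 'rV[R]_d).

Local Notation mu := (@lebesgue_rV R d).

(* Elements of L^2 are represented by measurable functions. *)
Definition L2 D f : Prop :=
  measurable_fun D f /\ mu.-integrable D (fun x => (f x ^+ 2)%:E).

Definition L2v D v : Prop := forall i, L2 D (fun x => v x 0 i).

Definition inner D f g : R := \int[mu]_(x in D) (f x * g x).

Definition innerv D v w : R := \int[mu]_(x in D) dotp (v x) (w x).

Definition normL2 D f : R := Num.sqrt (inner D f f).

Definition normL2v D v : R := Num.sqrt (innerv D v v).

End L2.

Section sobolev.
Context {R : realType} {d : nat}.
Implicit Types (D : set 'rV[R]_d) (u psi : 'rV[R]_d -> R)
  (g : 'rV[R]_d -> 'rV[R]_d).

Definition partial (i : 'I_d) u : 'rV[R]_d -> R :=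
  fun x => 'D_(delta_mx 0 i) u x.

(* C^infinity: all iterated partial derivatives are differentiable. *)
Definition smooth psi : Prop :=
  forall (s : seq 'I_d) x, differentiable (foldr partial psi s) x.

Definition support psi : set 'rV[R]_d := closure [set x | psi x != 0].

Definition test_function D psi : Prop :=
  [/\ smooth psi, compact (support psi) & support psi `<=` D].

Definition weak_gradient D u g : Prop :=
  forall psi, test_function D psi ->
  forall i, inner D u (partial i psi) = - inner D (fun x => g x 0 i) psi.

Definition H1 D u g : Prop := [/\ L2 D u, L2v D g & weak_gradient D u g].

Definition periodic (a b : 'rV[R]_d) u : Prop :=
  forall i x, u (x + (b 0 i - a 0 i) *: delta_mx 0 i) = u x.

(* A periodic H^1 function on the box is a periodic function on R^d that is
   in H^1_loc(R^d). *)
Definition H1per (a b : 'rV[R]_d) u g : Prop :=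
  [/\ periodic a b u,
      forall K, compact K -> L2 K u /\ L2v K g &
      weak_gradient [set: 'rV[R]_d] u g].

(* An element of V is a representative together with a representative of its
   weak gradient; the latter is determined almost everywhere by the former. *)
Record V (s : setting R d) := {
  V_fun :> 'rV[R]_d -> R;
  grad : 'rV[R]_d -> 'rV[R]_d;
  V_prop : match s with
           | Neumann Omega => H1 Omega V_fun grad
           | Periodic a b => H1per a b V_fun grad
           end }.

End sobolev.

Section model.
Context {R : realType}.
Implicit Types (sigma theta B x : R).

Definition mobility sigma x : R :=
  if 0 <= x <= 1 then 4^-1 * (1 - (1 - sigma) * (2 * x - 1) ^+ 2)
  else 8^-1 * sigma *
    (1 + expR (- (2 * (1 - sigma) * ((2 * x - 1) ^+ 2 - 1) / sigma))).

Definition flory_huggins sigma theta x : R :=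
  if 1 - sigma <= x then
    x * ln x + (1 - x) ^+ 2 / (2 * sigma) + (1 - x) * ln sigma - sigma / 2
    + theta * (x - x ^+ 2)
  else if sigma <= x then
    x * ln x + (1 - x) * ln (1 - x) + theta * (x - x ^+ 2)
  else
    (1 - x) * ln (1 - x) + x ^+ 2 / (2 * sigma) + x * ln sigma - sigma / 2
    + theta * (x - x ^+ 2).

Definition Hfun sigma theta B x : R :=
  derive1 (flory_huggins sigma theta) x /
  Num.sqrt (flory_huggins sigma theta x + B).

End model.

Definition energy {R : realType} {d : nat} (s : setting R d) (eps B : R)
    (phi : V s) (U : 'rV[R]_d -> R) : R :=
  eps ^+ 2 / 2 * normL2v (domain s) (grad phi) ^+ 2
  + normL2 (domain s) U ^+ 2
  - B * fine (lebesgue_rV d (domain s)).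

(* Main.v *)
Require Import Defs.
From mathcomp Require Import all_boot all_order all_algebra.
From mathcomp Require Import all_classical all_reals all_analysis.
From mathcomp Require Import measurable_realfun ring lra.
Import Order.TTheory GRing.Theory Num.Theory.
Import numFieldNormedType.Exports.

(** The energy law comes from testing the two weak equations with [mu1] and with
    [phi1 - phi].  The first equation gives
    [(phi1 - phi, mu1) / dt = - |sqrt M * grad mu1|^2].  The second one gives
    [(mu1, phi1 - phi) = eps^2 (grad phi1, grad phi1 - grad phi)
                         + (U1 H, phi1 - phi)],
    and the third equation turns the last term into [2 (U1, U1 - U)].  By
    [2 a (a - b) >= a^2 - b^2], applied to the gradients and to [U1], [U], the
    right-hand side is at least the increment of the energy.

    The second equation is tested with [phi1] and [phi] separately, and the two
    results are subtracted; so no new element of [V] has to be built, but each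
    of [U1 H phi1] and [U1 H phi] has to be integrable.  This holds because [H]
    is bounded: [Hfun_sqr_le].  The bound needs no study of the branches of the
    potential at infinity.  By Glaeser's inequality, a nonnegative function
    whose second derivative is at most [K] satisfies [F'^2 <= 2 K F], and this
    is a bound on [F' / sqrt F].  Since the Flory-Huggins potential is only
    piecewise of class C^2, the second derivative is replaced by the estimate
    [|F y - F x - F' x (y - x)| <= C (y - x)^2]
    ([flory_huggins_quadratic_remainder]).  That one estimate identifies the
    derivative at the junctions of the branches as well, makes [F'], hence [H],
    continuous, and yields Glaeser's inequality.

    On the measure-theoretic side, the domain has to be measurable for the
    sigma-algebra generated by the coordinates; this holds because an open set
    is a countable union of rational cubes ([open_measurable_rV]). *)

Local Open Scope classical_set_scope.
Local Open Scope ring_scope.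

(** * Functions with a quadratic first-order Taylor remainder *)

Section quadratic_remainder.
Context {R : realType}.
Implicit Types (F g : R -> R) (C x y : R).

(** A uniform, derivative-free substitute for a bound [2 C] on the absolute value
    of [F''], meaningful also for piecewise-defined [F]; [g] then has to be the
    derivative of [F]. *)
Definition quadratic_remainder F g C : Prop :=
  forall x y, `|F y - F x - g x * (y - x)| <= C * (y - x) ^+ 2.

Lemma quadratic_remainder_is_derive F g C x :
  quadratic_remainder F g C -> is_derive x (1 : R) F (g x).
Proof.
move=> Fg.
have FgD : h^-1 *: (F (h *: (1 : R) + x) - F x) @[h --> 0^'] --> g x.
  apply/cvgrPdist_le => e e0; near=> h.
  have h0 : h != 0 by near: h; exact: nbhs_dnbhs_neq.
  have := Fg x (h + x); rewrite addrK => Fgh.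
  rewrite -[leLHS]mul1r distrC -[X in X * _](divff (_ : `|h| != 0)) ?normr_eq0//.
  rewrite mulrAC -normrM /GRing.scale/= mulr1 mulrBr mulrA divff// mul1r.
  rewrite (mulrC h) ler_pdivrMr ?normr_gt0//; apply: (le_trans Fgh).
  rewrite -normr_id -real_normK ?num_real// normr_id expr2 mulrA.
  rewrite ler_wpM2r//; near: h.
  have Ce : 0 < e / (`|C| + 1) by rewrite divr_gt0// ltr_wpDl.
  exists (e / (`|C| + 1)) => //= h; rewrite /ball_/= sub0r normrN => hC _.
  have C0 : 0 < `|C| + 1 by rewrite ltr_wpDl.
  move: hC; rewrite ltr_pdivlMr// => hC.
  apply: (le_trans _ (ltW hC)); rewrite mulrC ler_wpM2l//.
  by rewrite (le_trans (ler_norm _))// lerDl.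
by apply: DeriveDef; [exact: (cvgP (g x))|exact: cvg_lim].
Unshelve. all: by end_near. Qed.

Lemma quadratic_remainder_continuous F g C :
  quadratic_remainder F g C -> continuous F.
Proof.
move=> Fg x; apply: differentiable_continuous; apply/derivable1_diffP.
by have [] := @quadratic_remainder_is_derive F g C x Fg.
Qed.

(** Adding the estimates at [(x, y)] and at [(y, x)] cancels the values of [F]
    and leaves [(g x - g y) * (x - y)]. *)
Lemma quadratic_remainder_lipschitz F g C x y :
  quadratic_remainder F g C -> `|g x - g y| <= 2 * C * `|x - y|.
Proof.
move=> Fg; have [->|xy] := eqVneq x y; first by rewrite !subrr normr0 mulr0.
have xy0 : 0 < `|x - y| by rewrite normr_gt0 subr_eq0.
rewrite -(ler_pM2r xy0) -normrM -!mulrA -expr2 real_normK ?num_real//.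
rewrite (_ : (g x - g y) * (x - y) = (F y - F x - g x * (y - x)) +
  (F x - F y - g y * (x - y))); last by ring.
apply: (le_trans (ler_normD _ _)).
by have := lerD (Fg x y) (Fg y x); rewrite -(sqrrN (y - x)) opprB; lra.
Qed.

Lemma quadratic_remainder_slope_continuous F g C :
  quadratic_remainder F g C -> continuous g.
Proof.
move=> Fg x; apply/cvgrPdist_le => e e0; near=> y.
apply: (le_trans (@quadratic_remainder_lipschitz F g C x y Fg)).
have C0 : 0 < 2 * `|C| + 1 by rewrite ltr_wpDl// mulr_ge0.
have : `|x - y| < e / (2 * `|C| + 1).
  by near: y; apply: cvgr_dist_lt => //; rewrite divr_gt0.
rewrite ltr_pdivlMr// => hy; apply: le_trans (ltW hy).
by rewrite mulrC ler_wpM2l//; have := ler_norm C; lra.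
Unshelve. all: by end_near. Qed.

(** The parabola [F x + g x * h + C * h^2] stays above [F (x + h) >= 0] for every
    [h]; its value at its minimum is [F x - g x ^+ 2 / (4 * C)]. *)
Lemma glaeser_inequality F g C x :
  0 < C -> quadratic_remainder F g C -> (forall y, 0 <= F y) ->
  g x ^+ 2 <= 4 * C * F x.
Proof.
move=> C0 Fg F0.
(* The minimum of the parabola is at h = - g x / (2 C). *)
have := F0 (x - g x / (2 * C)).
have := ler_normlW (Fg x (x - g x / (2 * C))).
set y := x - _ => Fy Fy0.
have yx : (y - x) * (2 * C) = - g x by rewrite /y; field; rewrite gt_eqF.
have Cy2 : C * (C * (y - x) ^+ 2) * 4 = g x ^+ 2 by rewrite -[g x]opprK -yx; ring.
have : 0 <= C * (F x + g x * (y - x) + C * (y - x) ^+ 2).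
  by rewrite mulr_ge0 ?(ltW C0)//; lra.
have : C * (g x * (y - x)) * 2 = - g x ^+ 2.
  transitivity (g x * ((y - x) * (2 * C))); first by ring.
  by rewrite yx; ring.
lra.
Qed.

End quadratic_remainder.

(** * The regularized entropy and the boundedness of H *)

Section entropy.
Context {R : realType}.
Implicit Types (s x y : R).

Lemma ln_tangent x y : 0 < x -> 0 < y -> ln y - ln x <= (y - x) / x.
Proof.
move=> x0 y0; rewrite -ln_div ?posrE//.
rewrite (_ : y / x = 1 + (y - x) / x); last by field; rewrite gt_eqF.
apply: le_ln1Dx; rewrite ltr_pdivlMr//; lra.
Qed.

Lemma xlnx_lower x y : 0 < x -> 0 < y -> y - x <= y * (ln y - ln x).
Proof.
move=> x0 y0; have := ln_tangent _ _ y0 x0.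
by rewrite -(ler_pM2l y0) mulrCA divff ?gt_eqF// mulr1; lra.
Qed.

Lemma xlnx_upper s x y : 0 < s -> s <= x -> 0 < y ->
  y * (ln y - ln x) <= y - x + s^-1 * (y - x) ^+ 2.
Proof.
move=> s0 sx y0; have x0 := lt_le_trans s0 sx.
have := ln_tangent _ _ x0 y0; rewrite -(ler_pM2l y0) => /le_trans; apply.
rewrite (_ : y * _ = y - x + x^-1 * (y - x) ^+ 2); last by field; rewrite gt_eqF.
by rewrite lerD2l ler_wpM2r ?sqr_ge0// lef_pV2.
Qed.

(** [x ln x], continued below [s] by its second-order Taylor polynomial at [s].
    Up to the term in [theta], the Flory-Huggins potential is the sum of this
    function at [x] and at [1 - x], which leaves a single junction to study. *)
Definition entropy s x : R :=
  if s <= x then x * ln x else x ^+ 2 / (2 * s) + x * ln s - s / 2.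

Definition entropy_slope s x : R :=
  if s <= x then ln x + 1 else x / s + ln s.

(** Morally, the second derivative lies between 0 and [1 / s] everywhere.  On each
    side of [s] the estimate is the tangent inequality for [ln], or an
    identity; when [x] and [y] lie on different sides, the tangent inequality
    is used between [s] and the point above [s]. *)
Lemma entropy_quadratic_remainder s : 0 < s ->
  quadratic_remainder (entropy s) (entropy_slope s) s^-1.
Proof.
move=> s0 x y; rewrite /entropy /entropy_slope invfM.
have k0 : 0 <= s^-1 by rewrite invr_ge0 ltW.
(* With these products cancelled, every case is linear in the monomials in
   s^-1, x, y, ln x, ln y and ln s. *)
have ks z : s^-1 * s * z = z by rewrite mulVf ?mul1r// gt_eqF.
have := ks s; have := ks x; have := ks y.
have [sx|xs] := leP s x; have [sy|ys] := leP s y.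
- have x0 := lt_le_trans s0 sx; have y0 := lt_le_trans s0 sy.
  have := xlnx_lower _ _ x0 y0; have := xlnx_upper _ _ _ s0 sx y0.
  have := mulr_ge0 k0 (sqr_ge0 (y - x)).
  by move=> *; rewrite ler_norml; apply/andP; split; lra.
- have x0 := lt_le_trans s0 sx.
  have lnxs : 0 <= ln x - ln s by rewrite subr_ge0 ler_ln ?posrE.
  have lnu := ln_tangent _ _ s0 x0.
  have lnl : (x - s) / x <= ln x - ln s.
    by have := ln_tangent _ _ x0 s0; rewrite -(opprB x s) mulNr; lra.
  (* Here y < s <= x, and y * ln x has to be compared with y * ln s; which bound
     on ln x - ln s gives which side of the estimate depends on the sign of y. *)
  have sy2 := mulr_ge0 k0 (sqr_ge0 (s - y)).
  have sysx : 0 <= s^-1 * ((s - y) * (x - s)).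
    by rewrite mulr_ge0// mulr_ge0 ?subr_ge0// ltW.
  have xs2 := mulr_ge0 k0 (sqr_ge0 (x - s)).
  have [y0|y0] := leP 0 y.
    have up : y * (ln x - ln s) <= y * ((x - s) / s) by rewrite ler_wpM2l.
    have lo : s^-1 * ((x - s) * (y - (x - s))) <= y * (ln x - ln s).
      apply: le_trans (ler_wpM2l y0 lnl); rewrite -subr_ge0.
      rewrite (_ : _ - _ = (x - s) * ((x - s) * (x - y)) / (s * x)); last first.
        by field; rewrite !gt_eqF.
      rewrite divr_ge0 ?mulr_ge0 ?subr_ge0 ?(ltW s0) ?(ltW x0)//.
      by rewrite (le_trans (ltW ys)).
    by move=> *; rewrite ler_norml; apply/andP; split; lra.
  have up : y * (ln x - ln s) <= 0 by rewrite nmulr_rle0.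
  have lo : y * ((x - s) / s) <= y * (ln x - ln s) by rewrite ler_wnM2l// ltW.
  have := mulr_ge0 k0 (sqr_ge0 y).
  have : 0 <= s^-1 * (- y * (x - s)).
    by rewrite mulr_ge0// mulr_ge0 ?subr_ge0// oppr_ge0 ltW.
  by move=> *; rewrite ler_norml; apply/andP; split; lra.
- have y0 := lt_le_trans s0 sy.
  have := xlnx_lower _ _ s0 y0; have := xlnx_upper _ _ _ s0 (lexx s) y0.
  have := mulr_ge0 k0 (sqr_ge0 (s - x)); have := mulr_ge0 k0 (sqr_ge0 (y - x)).
  have : 0 <= s^-1 * ((s - x) * (y - s)).
    by rewrite mulr_ge0// mulr_ge0 ?subr_ge0// ltW.
  by move=> *; rewrite ler_norml; apply/andP; split; lra.
- have := mulr_ge0 k0 (sqr_ge0 (y - x)).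
  by move=> *; rewrite ler_norml; apply/andP; split; lra.
Qed.

(** Since [s < 1 / 2], at most one of [x], [1 - x] is below [s]. *)
Lemma flory_hugginsE s theta x : 0 < s < 2^-1 ->
  flory_huggins s theta x =
  entropy s x + entropy s (1 - x) + theta * (x - x ^+ 2).
Proof.
move=> /andP[s0 s2]; rewrite /flory_huggins /entropy.
have sN0 : s != 0 by rewrite gt_eqF.
have [x1|x1] := leP (1 - s) x.
  have -> : s <= x by lra.
  have [sx|sx] := leP s (1 - x); last by ring.
  (* The two closed-form branches overlap at x = 1 - s, where they agree. *)
  have -> : x = 1 - s by lra.
  rewrite (_ : 1 - (1 - s) = s); last by ring.
  by field.
have -> : s <= 1 - x by lra.
by have [] := leP s x => _; ring.
Qed.

Definition flory_huggins_slope s theta x : R :=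
  entropy_slope s x - entropy_slope s (1 - x) + theta * (1 - 2 * x).

Lemma flory_huggins_quadratic_remainder s theta B : 0 < s < 2^-1 -> 0 < theta ->
  quadratic_remainder (fun x => flory_huggins s theta x + B)
    (flory_huggins_slope s theta) (2 / s + theta).
Proof.
move=> s02 t0 x y; have /andP[s0 _] := s02; rewrite !flory_hugginsE//.
have Ex := entropy_quadratic_remainder _ s0 x y.
have E1x := entropy_quadratic_remainder _ s0 (1 - x) (1 - y).
have t2 : `|- (theta * (y - x) ^+ 2)| <= theta * (y - x) ^+ 2.
  by rewrite normrN ger0_norm// mulr_ge0 ?sqr_ge0// ltW.
rewrite (_ : _ - _ = (entropy s y - entropy s x - entropy_slope s x * (y - x)) +
  (entropy s (1 - y) - entropy s (1 - x)
    - entropy_slope s (1 - x) * ((1 - y) - (1 - x)))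
  + - (theta * (y - x) ^+ 2)); last by rewrite /flory_huggins_slope; ring.
apply: (le_trans (ler_normD _ _)).
apply: (le_trans (lerD (le_trans (ler_normD _ _) (lerD Ex E1x)) t2)).
by rewrite le_eqVlt; apply/orP; left; apply/eqP; ring.
Qed.

Lemma HfunE s theta B x : 0 < s < 2^-1 -> 0 < theta ->
  Hfun s theta B x =
  flory_huggins_slope s theta x / Num.sqrt (flory_huggins s theta x + B).
Proof.
move=> s02 t0; rewrite /Hfun derive1E; congr (_ / _).
have := flory_huggins_quadratic_remainder _ _ 0 s02 t0.
under [fun x => _]funext do rewrite addr0.
by move/quadratic_remainder_is_derive => /(_ x)[].
Qed.

(** Glaeser's inequality for [F + B]: its positivity on the whole line, together
    with the quadratic remainder, controls the derivative by the square root. *)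
Lemma Hfun_sqr_le s theta B x : 0 < s < 2^-1 -> 0 < theta ->
  (forall y, 0 < flory_huggins s theta y + B) ->
  Hfun s theta B x ^+ 2 <= 4 * (2 / s + theta).
Proof.
move=> s02 t0 F0; have /andP[s0 _] := s02; rewrite HfunE// expr_div_n sqr_sqrtr; last exact: ltW.
rewrite ler_pdivrMr//.
have := flory_huggins_quadratic_remainder _ _ B s02 t0.
move/(glaeser_inequality _ _ _ x); apply => // [|y]; last exact: ltW.
by rewrite addr_gt0// divr_gt0.
Qed.

Lemma Hfun_continuous s theta B : 0 < s < 2^-1 -> 0 < theta ->
  (forall y, 0 < flory_huggins s theta y + B) -> continuous (Hfun s theta B).
Proof.
move=> s02 t0 F0.
have Fg := flory_huggins_quadratic_remainder _ _ B s02 t0.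
rewrite (_ : Hfun s theta B = fun x =>
  flory_huggins_slope s theta x / Num.sqrt (flory_huggins s theta x + B)); last first.
  by apply/funext => x; exact: HfunE.
move=> x; apply: cvgM; first exact: (quadratic_remainder_slope_continuous _ _ _ Fg).
apply: cvgV; first by rewrite sqrtr_eq0 -ltNge.
apply: continuous_comp; last exact: sqrt_continuous.
exact: (quadratic_remainder_continuous _ _ _ Fg).
Qed.

End entropy.

(** * Measurability of the domains *)

Section domains_rV.
Context {R : realType} {n : nat}.
Implicit Types (A O : set 'rV[R]_n) (f g : 'rV[R]_n -> R).

Lemma measurable_cylinder (B : 'I_n -> set R) : (forall i, measurable (B i)) ->
  measurable [set x : 'rV[R]_n | forall i, B i (x 0 i)].
Proof.
move=> mB; rewrite (_ : mkset _ = \bigcap_(i in [set: 'I_n])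
   (fun x : 'rV[R]_n => x 0 i : measurableTypeR R) @^-1` B i); last first.
  by apply/seteqP; split=> [x h i _|x h i]; [exact: (h i)|exact: (h i I)].
apply: fin_bigcap_measurable => // i _.
by rewrite -[X in measurable X]setTI; apply: measurable_coor => //; exact: mB.
Qed.

(** Cubes with rational centres and radii [1 / (k + 1)] are countably many
    cylinders, and those contained in an open set cover it. *)
Lemma open_measurable_rV O : open O -> measurable O.
Proof.
move=> oO.
pose c (p : 'rV[rat]_n * nat) : set 'rV[R]_n :=
  [set x | forall i, ball (ratr (p.1 0 i) : R) p.2.+1%:R^-1 (x 0 i)].
pose c' p := if `[< c p `<=` O >] then c p else set0.
have -> : O = \bigcup_p c' p.
  apply/seteqP; split => [x Ox|x [p _]]; last first.
    by rewrite /c'; case: asboolP => // + cx; exact.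
  have /nbhs_ballP[e /= e0 xeO] : nbhs x O by exact: open_nbhs_nbhs.
  (* With radius below e / 2, a cube that contains x lies in ball x e. *)
  have e20 : 0 < e / 2 by rewrite divr_gt0.
  have [k ke] : exists k : nat, k.+1%:R^-1 < e / 2.
    exists (Num.truncn (e / 2)^-1); rewrite invf_plt ?posrE//.
    by rewrite truncnS_gt.
  have k0 : 0 < k.+1%:R^-1 :> R by rewrite invr_gt0.
  have q_ i : exists q : rat, ball (ratr q : R) k.+1%:R^-1 (x 0 i).
    have [|q] := @rat_in_itvoo R (x 0 i - k.+1%:R^-1) (x 0 i + k.+1%:R^-1).
      by rewrite ltrBlDr -addrA ltrDl addr_gt0.
    rewrite in_itv/= => /andP[q1 q2]; exists q.
    rewrite -ball_normE/= ltr_norml; move: q1 q2; move: (k.+1%:R^-1 : R) => r.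
    by move=> *; apply/andP; split; lra.
  have [q qx] := choice q_.
  have cx : c (\row_i q i, k) x by move=> i; rewrite /= mxE.
  exists (\row_i q i, k) => //; rewrite /c' asboolT// => y cy.
  apply: xeO; split => // i j; rewrite (ord1 i).
  have := cx j; have := cy j; rewrite -!ball_normE/= mxE !ltr_norml.
  move: ke; move: (k.+1%:R^-1 : R) => r ke.
  by move=> /andP[? ?] /andP[? ?]; apply/andP; split; lra.
apply: countable_bigcupT_measurable => [|p]; first exact: countableP.
rewrite /c'; case: asboolP => // _.
apply: (measurable_cylinder (fun i => ball (ratr (p.1 0 i) : R) p.2.+1%:R^-1)) => i.
exact: measurable_ball.
Qed.

Lemma measurable_box (a b : 'rV[R]_n) : measurable (box a b).
Proof.
rewrite (_ : box a b = [set x | forall i, `]a 0 i, b 0 i[%classic (x 0 i)]).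
  apply: (measurable_cylinder (fun i => `]a 0 i, b 0 i[%classic)) => i.
  exact: measurable_itv.
by apply/seteqP; split => x /= h i; have := h i; rewrite /= in_itv.
Qed.

Lemma admissible_measurable (s : setting R n) :
  admissible s -> measurable (domain s).
Proof.
case: s => [W|a b] /=; last by move=> _; exact: measurable_box.
by move=> [+ _ _ _ _]; exact: open_measurable_rV.
Qed.

End domains_rV.

(** * Square-integrable functions *)

Section L2_theory.
Context {R : realType} {n : nat} (D : set 'rV[R]_n) (mD : measurable D).
Implicit Types (f g h : 'rV[R]_n -> R) (v w : 'rV[R]_n -> 'rV[R]_n).
Local Notation mu := (@lebesgue_rV R n).

Lemma L2_subset (K : set 'rV[R]_n) f : measurable K -> D `<=` K -> L2 K f -> L2 D f.
Proof.
move=> mK DK [mf if2]; split; first exact: measurable_funS mf.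
exact: integrableS if2.
Qed.

Lemma L2_mul_integrable f g : L2 D f -> L2 D g ->
  mu.-integrable D (EFin \o (fun x => f x * g x)).
Proof.
move=> [mf if2] [mg ig2].
apply: le_integrable (integrableD mD if2 ig2) => //.
  by apply/measurable_EFinP; exact: measurable_funM.
move=> x _ /=; rewrite lee_fin [leRHS]ger0_norm ?addr_ge0 ?sqr_ge0//.
rewrite ler_norml; apply/andP; split.
  by have := sqr_ge0 (f x + g x); have := sqr_ge0 (f x); have := sqr_ge0 (g x); lra.
by have := sqr_ge0 (f x - g x); have := sqr_ge0 (f x); have := sqr_ge0 (g x); lra.
Qed.

(** Applied to [U1] and [H (phi)], this makes [U1 H (phi) chi] integrable for all
    [chi] in [L2], so that integrals of such products can be subtracted. *)
Lemma L2_mul_bounded f h (K : R) : L2 D f -> measurable_fun D h ->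
  (forall x, D x -> h x ^+ 2 <= K) -> L2 D (fun x => f x * h x).
Proof.
move=> [mf if2] mh hK; have mfh := measurable_funM mf mh; split => //.
have /= := integrableZl mD K if2; apply: le_integrable => //.
  by apply/measurable_EFinP; exact: measurable_funX.
move=> x Dx /=; rewrite lee_fin exprMn normrM [leRHS]normrM mulrC.
by rewrite ler_wpM2r// ger0_norm ?sqr_ge0//; apply: (le_trans (hK _ Dx)); exact: ler_norm.
Qed.

Lemma L2v_dotp_integrable v w : L2v D v -> L2v D w ->
  mu.-integrable D (EFin \o (fun x => dotp (v x) (w x))).
Proof.
move=> v2 w2; rewrite (_ : _ \o _ =
  fun x => (\sum_i (v x 0 i * w x 0 i)%:E)%E); last first.
  by apply/funext => x; rewrite /= /dotp sumEFin.
by apply: integrable_sum => // i _; exact: L2_mul_integrable.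
Qed.

Lemma dotp_ge0 (x : 'rV[R]_n) : 0 <= dotp x x.
Proof. by apply: sumr_ge0 => i _; rewrite -expr2 sqr_ge0. Qed.

Lemma normL2_sqr f : normL2 D f ^+ 2 = inner D f f.
Proof.
rewrite sqr_sqrtr//; apply: Rintegral_ge0 => x _.
by rewrite -expr2 sqr_ge0.
Qed.

Lemma normL2v_sqr v : normL2v D v ^+ 2 = innerv D v v.
Proof. by rewrite sqr_sqrtr//; apply: Rintegral_ge0 => x _; exact: dotp_ge0. Qed.

Lemma innerC f g : inner D f g = inner D g f.
Proof. by apply: eq_Rintegral => x _; rewrite mulrC. Qed.

Lemma inner_subl f g h : L2 D f -> L2 D g -> L2 D h ->
  inner D (fun x => f x - g x) h = inner D f h - inner D g h.
Proof.
move=> f2 g2 h2; rewrite /inner; under eq_Rintegral do rewrite mulrBl.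
by rewrite RintegralB//; exact: L2_mul_integrable.
Qed.

Lemma inner_le f g : L2 D f -> L2 D g ->
  2 * inner D f g <= normL2 D f ^+ 2 + normL2 D g ^+ 2.
Proof.
move=> f2 g2; rewrite !normL2_sqr /inner.
have ff := L2_mul_integrable _ _ f2 f2; have gg := L2_mul_integrable _ _ g2 g2.
have fg := L2_mul_integrable _ _ f2 g2.
rewrite -RintegralZl// -RintegralD//; apply: le_Rintegral => //.
- exact: (integrableZl mD 2 fg).
- exact: (integrableD mD ff gg).
- by move=> x _; have := sqr_ge0 (f x - g x); lra.
Qed.

Lemma innerv_le v w : L2v D v -> L2v D w ->
  2 * innerv D v w <= normL2v D v ^+ 2 + normL2v D w ^+ 2.
Proof.
move=> v2 w2; rewrite !normL2v_sqr /innerv.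
have vv := L2v_dotp_integrable _ _ v2 v2; have ww := L2v_dotp_integrable _ _ w2 w2.
have vw := L2v_dotp_integrable _ _ v2 w2.
rewrite -RintegralZl// -RintegralD//; apply: le_Rintegral => //.
- exact: (integrableZl mD 2 vw).
- exact: (integrableD mD vv ww).
- move=> x _; rewrite /dotp mulr_sumr -big_split; apply: ler_sum => i _ /=.
  by have := sqr_ge0 (v x 0 i - w x 0 i); lra.
Qed.

Lemma innerv_sqrt_weight (m : 'rV[R]_n -> R) v : (forall x, D x -> 0 <= m x) ->
  innerv D (fun x => m x *: v x) v
  = normL2v D (fun x => Num.sqrt (m x) *: v x) ^+ 2.
Proof.
move=> m0; rewrite normL2v_sqr; apply: eq_Rintegral => x /set_mem Dx.
apply: eq_bigr => i _; rewrite !mxE mulrACA -expr2 sqr_sqrtr ?m0//.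
by rewrite mulrA.
Qed.

End L2_theory.

(** * Elements of V on their domain *)

Section V_theory.
Context {R : realType} {n : nat}.

(** In the periodic case the L2 bounds come on compact sets only, and are applied
    to the closed box. *)
Lemma V_L2 (s : setting R n) (u : V s) : admissible s ->
  L2 (domain s) u /\ L2v (domain s) (grad u).
Proof.
move=> As; have mD := admissible_measurable s As.
case: s As mD u => [W|a b] As mD [u g] /=; first by case.
case=> _ uK _.
pose K : set 'rV[R]_n := [set x | forall i, `[a 0 i, b 0 i]%classic (x ord0 i)].
have cK : compact K.
  by apply: (@rV_compact R _ (fun i => `[a 0 i, b 0 i]%classic)) => i; exact: segment_compact.
have mK : measurable K.
  apply: (measurable_cylinder (fun i => `[a 0 i, b 0 i]%classic)) => i.
  exact: measurable_itv.
have DK : box a b `<=` K.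
  by move=> x abx i; have /andP[? ?] := abx i; rewrite /= in_itv/= !ltW.
have [u2 g2] := uK K cK; split; first exact: (L2_subset _ mD _ _ mK DK).
by move=> i; exact: (L2_subset _ mD _ _ mK DK).
Qed.

End V_theory.

Lemma mobility_ge0 {R : realType} (sigma x : R) : 0 < sigma < 1 ->
  0 <= mobility sigma x.
Proof.
move=> /andP[s0 s1]; rewrite /mobility; case: ifPn => [/andP[x0 x1]|_].
  rewrite mulr_ge0//.
  rewrite (_ : 1 - (1 - sigma) * _ = sigma + (1 - sigma) * (4 * (x * (1 - x)))); last by ring.
  by rewrite addr_ge0 ?(ltW s0)// mulr_ge0 ?subr_ge0 ?(ltW s1)// !mulr_ge0 ?subr_ge0.
by rewrite mulr_ge0 ?mulr_ge0 ?(ltW s0)// addr_ge0// expR_ge0.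
Qed.

(** * Energy dissipation *)

Theorem theorem3p2 (R : realType) (d : nat) (s : setting R d)
    (eps theta sigma B dt : R)
    (phi phi1 mu1 : V s) (U U1 : 'rV[R]_d -> R) :
  (0 < d)%N -> admissible s ->
  0 < eps -> 1 < theta -> 0 < sigma < 2^-1 ->
  (forall x, 0 < flory_huggins sigma theta x + B) ->
  0 < dt ->
  L2 (domain s) U -> L2 (domain s) U1 ->
  (forall chi : V s,
     dt^-1 * inner (domain s) (fun x => phi1 x - phi x) chi
     = - innerv (domain s)
                (fun x => mobility sigma (phi x) *: grad mu1 x) (grad chi)) ->
  (forall chi : V s,
     inner (domain s) mu1 chi
     = eps ^+ 2 * innerv (domain s) (grad phi1) (grad chi)
       + inner (domain s) (fun x => U1 x * Hfun sigma theta B (phi x)) chi) ->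
  {ae lebesgue_rV d, forall x, domain s x ->
     2 * (U1 x - U x) = Hfun sigma theta B (phi x) * (phi1 x - phi x)} ->
  dt^-1 * (energy eps B phi1 U1 - energy eps B phi U)
    <= - normL2v (domain s)
           (fun x => Num.sqrt (mobility sigma (phi x)) *: grad mu1 x) ^+ 2
    <= 0.
Proof.
move=> _ As eps0 theta1 s02 F0 dt0 U2 U12 eqphi eqmu eqU.
have theta0 : 0 < theta by rewrite (lt_trans _ theta1).
have s01 : 0 < sigma < 1 by move: s02 => /andP[? ?]; apply/andP; split; lra.
have mD := admissible_measurable s As.
have [phi2 gphi2] := V_L2 s phi As.
have [phi12 gphi12] := V_L2 s phi1 As.
have [mu12 gmu12] := V_L2 s mu1 As.
pose h x := Hfun sigma theta B (phi x).
have mh : measurable_fun (domain s) h.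
  apply: measurableT_comp; last by case: phi2.
  by apply: continuous_measurable_fun; exact: Hfun_continuous.
have Uh2 : L2 (domain s) (fun x => U1 x * h x).
  by apply: (L2_mul_bounded _ mD _ _ _ U12 mh) => x _; exact: Hfun_sqr_le.
(* The difference of the two tests of the potential term, rewritten almost
   everywhere by the third equation. *)
have potential : inner (domain s) (fun x => U1 x * h x) phi1
    - inner (domain s) (fun x => U1 x * h x) phi
    = 2 * (inner (domain s) U1 U1 - inner (domain s) U1 U).
  have i1 := L2_mul_integrable _ mD _ _ Uh2 phi12.
  have i0 := L2_mul_integrable _ mD _ _ Uh2 phi2.
  have j1 := L2_mul_integrable _ mD _ _ U12 U12.
  have j0 := L2_mul_integrable _ mD _ _ U12 U2.
  rewrite /inner -!RintegralB// -RintegralZl//; last exact: (integrableB mD j1 j0).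
  congr fine; apply: ae_eq_integral => //.
  - exact: (measurable_int _ (integrableB mD i1 i0)).
  - exact: (measurable_int _ (integrableZl mD 2 (integrableB mD j1 j0))).
  apply: filterS eqU => x eqUx Dx; congr EFin.
  transitivity (U1 x * (h x * (phi1 x - phi x))); first by rewrite /=; ring.
  by rewrite /h -(eqUx Dx) /=; ring.
have dissipation : dt^-1 * inner (domain s) (fun x => phi1 x - phi x) mu1
    = - normL2v (domain s)
          (fun x => Num.sqrt (mobility sigma (phi x)) *: grad mu1 x) ^+ 2.
  by rewrite eqphi innerv_sqrt_weight// => x _; exact: mobility_ge0.
rewrite oppr_le0 sqr_ge0 andbT -dissipation ler_pM2l ?invr_gt0//.
rewrite inner_subl// !(innerC _ _ mu1) !eqmu /energy.
have le_grad := ler_wpM2l (sqr_ge0 eps) (innerv_le _ mD _ _ gphi12 gphi2).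
have le_U := inner_le _ mD _ _ U12 U2.
move: potential le_grad le_U; rewrite -!normL2_sqr -!normL2v_sqr.
lra.
Qed.
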